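(* Let $f\colon X\to X$ be a cellular self-map of a finite connected CW complex. The following hold. (i) $\mathcal M_f(B)$ is nondecreasing in $B$ and $0\le\mathcal M_f(B)\le\|\mathrm{RT}(f)\|_1$. (ii) $\mathrm{cfc}(f)=\min\{B:\mathcal M_f(B)=\|\mathrm{RT}(f)\|_1\}$. (iii) If $N(f)>0$, then, in $\mathbb N\cup\{\infty\}$, $\mathrm{dc}(f)\le\mathrm{cfc}(f)\le\mathrm{oc}(f)$. (iv) $\mathrm{cfc}(f)=1$ if and only if $|L(f)|=\|\mathrm{RT}(f)\|_1$. In particular, if all coefficients of $\mathrm{RT}(f)$ have one sign, then $\mathrm{cfc}(f)=1$. (v) If $L(f)\ne0$, then $\mathrm{dc}(f)=1$. (vi) If $N'\subseteq N$ are finite observers and $\mathrm{RT}_N(f)\ne0$, then $\mathrm{RT}_{N'}(f)\neq0$.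
   Context: Let $G=\pi_1(X,x_0)$. A choice of lift $\tilde f$ of $f$ to the universal cover $p\colon\tilde X\to X$ determines $\phi\in\mathrm{End}(G)$ with $\tilde f(g\tilde x)=\phi(g)\tilde f(\tilde x)$. Write $a\sim_\phi b$ if $b=ga\phi(g)^{-1}$ for some $g\in G$; $\mathcal R(\phi)$ is the set of classes. The Reidemeister trace is $\mathrm{RT}(f)=\sum_{\alpha}I_f(\alpha)[\alpha]\in\mathbb Z[\mathcal R(\phi)]$, where for $\alpha=[a]$, $I_f(\alpha)$ is the fixed-point index of the fixed-point class $p(\mathrm{Fix}(a\tilde f))$. Its finite support is $E_f$; $N(f)=\#E_f$ is the Nielsen number, $L(f)=\sum_\alpha I_f(\alpha)$ the Lefschetz number, and $\|\cdot\|_1$ denotes the sum of absolute values of coefficients. A finite observer is a finite-index normal subgroup $N\triangleleft G$ with $\phi(N)\subseteq N$; with $q_N\colon G\to G/N$ and induced $\bar\phi_N$, it gives $(q_N)_R\colon\mathcal R(\phi)\to\mathcal R(\bar\phi_N)$, $[a]\mapsto[q_N(a)]$, and the observed trace $\mathrm{RT}_N(f)$ is the pushforward of $\mathrm{RT}(f)$ along $(q_N)_R$. Put $M_N(f)=\|\mathrm{RT}_N(f)\|_1$. For $B\in\mathbb N$ ($B\ge1$), $\mathcal M_f(B)$ is the maximum of $M_N(f)$ over finite observers $N$ with $[G:N]\le B$. Further, $\mathrm{dc}(f)$, $\mathrm{cfc}(f)$, $\mathrm{oc}(f)$ are the minima of $[G:N]$ over finite observers $N$ with, respectively, $\mathrm{RT}_N(f)\neq0$;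 $M_N(f)=\|\mathrm{RT}(f)\|_1$; $(q_N)_R|_{E_f}$ injective (each $\infty$ if no such $N$ exists; minima of empty sets are $\infty$). *)

(* Defs.v *)
From HB Require Import structures.
From mathcomp Require Import all_boot all_order all_algebra generic_quotient finmap.
From mathcomp Require Import all_classical all_reals all_analysis ring lra.

Set Implicit Arguments.
Unset Strict Implicit.
Unset Printing Implicit Defensive.

Import Order.TTheory GRing.Theory Num.Theory.
Import numFieldTopology.Exports numFieldNormedType.Exports.

Local Open Scope classical_set_scope.
Local Open Scope ring_scope.
Local Open Scope quotient_scope.

Section Within.
Context {T U V : topologicalType}.

Lemma within_comp (A : set T) (B : set U) (g : T -> U) (f : U -> V) :
  {within B, continuous f} -> {within A, continuous g} ->
  (forall x, A x -> B (g x)) -> {within A, continuous (f \o g)}.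
Proof.
move=> cf cg gAB; apply/subspace_continuousP => x Ax.
move/subspace_continuousP : cf => /(_ (g x) (gAB _ Ax)) cf.
move/subspace_continuousP : cg => /(_ x Ax) cg.
move=> P /cf fP.
have gP : nbhs x (fun y => A y -> B (g y) -> P (f (g y))) := cg _ fP.
suff : nbhs x (fun y => A y -> P (f (g y))) by [].
by apply: filterS gP => y gP Ay; apply: gP => //; exact: gAB.
Qed.

End Within.

Lemma within_paste {R : realType} {T U : topologicalType} (D : set T)
    (c : T -> R) (a : R) (f g h : T -> U) :
  closed D -> continuous c ->
  {within D `&` [set x | c x <= a], continuous g} ->
  {within D `&` [set x | a <= c x], continuous h} ->
  (forall x, D x -> c x <= a -> f x = g x) ->
  (forall x, D x -> a <= c x -> f x = h x) ->
  {within D, continuous f}.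
Proof.
move=> cD cc cg ch fg fh.
have -> : D = (D `&` [set x | c x <= a]) `|` (D `&` [set x | a <= c x]).
  apply/seteqP; split => [x Dx|x [[]|[]]//].
  by case: (leP (c x) a) => [?|/ltW ?]; [left|right].
apply: withinU_continuous.
- apply: closedI => //.
  exact: ((continuous_closedP c).1 cc _ (@closed_le _ a)).
- apply: closedI => //.
  exact: ((continuous_closedP c).1 cc _ (@closed_ge _ a)).
- by apply: subspace_eq_continuous cg => x /set_mem[Dx xa]; exact/esym/fg.
- by apply: subspace_eq_continuous ch => x /set_mem[Dx xa]; exact/esym/fh.
Qed.

Lemma continuous_pair (S T U : topologicalType) (f : S -> T) (g : S -> U) :
  continuous f -> continuous g -> continuous (fun x => (f x, g x)).
Proof. by move=> cf cg x; apply: cvg_pair; [exact: cf|exact: cg]. Qed.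

(* Paths and homotopies are functions on R (resp. R * R) of which only the
   restriction to `[0, 1] (resp. its square) matters. *)
Section Paths.
Context {R : realType} {T : topologicalType}.
Implicit Types (x y : T) (u v w : R -> T).

Definition is_path x y u :=
  [/\ {within `[0, 1], continuous u}, u 0 = x & u 1 = y].

Definition path_concat u v : R -> T :=
  fun t => if t <= 2^-1 then u (2 * t) else v (2 * t - 1).

Definition path_rev u : R -> T := fun t => u (1 - t).

(* Homotopy relative to the endpoints. *)
Definition homotopic u v := exists H : R * R -> T,
  [/\ {within `[0, 1] `*` `[0, 1], continuous H},
      forall t, 0 <= t <= 1 -> H (0, t) = u t /\ H (1, t) = v t
    & forall s, 0 <= s <= 1 -> H (s, 0) = u 0 /\ H (s, 1) = u 1].

Let sq : set (R * R) := `[0, 1] `*` `[0, 1].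

Let closed_sq : closed sq.
Proof.
rewrite (_ : sq = fst @^-1` `[0, 1] `&` snd @^-1` `[0, 1])//.
apply: closedI.
- by apply: ((continuous_closedP (@fst R R)).1 _ _ (@itv_closed _ R 0 1)) => ?; exact: cvg_fst.
- by apply: ((continuous_closedP (@snd R R)).1 _ _ (@itv_closed _ R 0 1)) => ?; exact: cvg_snd.
Qed.

Let sqE s t : sq (s, t) = (0 <= s <= 1) && (0 <= t <= 1) :> Prop.
Proof.
by rewrite propeqE /sq /= !in_itv/=; split => [[-> ->]|/andP[]].
Qed.

Lemma path_concat_path x y z u v :
  is_path x y u -> is_path y z v -> is_path x z (path_concat u v).
Proof.
move=> [cu u0 u1] [cv v0 v1]; split; last 2 first.
- by rewrite /path_concat mulr0 ifT// invr_ge0.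
- rewrite /path_concat ifF; first by rewrite mulr1 (_ : 2 - 1 = 1 :> R)//; lra.
  by apply/negbTE; rewrite -ltNge; lra.
apply: (@within_paste _ _ _ _ id 2^-1 _ (u \o *%R 2)
  (v \o (fun t => 2 * t - 1))) => //.
- exact: itv_closed.
- by move=> ?; exact: cvg_id.
- apply: (@within_comp R R T _ `[0, 1] ( *%R 2) u cu) => [|t]; last by rewrite /= !in_itv/= => -[/andP[? ?] ?]; lra.
  by apply: continuous_subspaceT => t; exact: mulrl_continuous.
- apply: (@within_comp R R T _ `[0, 1] (fun t => 2 * t - 1) v cv) => [|t]; last by rewrite /= !in_itv/= => -[/andP[? ?] ?]; lra.
  apply: continuous_subspaceT => t; apply: cvgB; last exact: cvg_cst.
  exact: mulrl_continuous.
- by move=> t _ t2; rewrite /path_concat t2.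
- move=> t _; rewrite le_eqVlt => /predU1P[<-|t2].
    by rewrite /path_concat lexx /= mulfV// subrr u1 v0.
  by rewrite /path_concat leNgt t2.
Qed.

Lemma path_rev_path x y u : is_path x y u -> is_path y x (path_rev u).
Proof.
move=> [cu u0 u1]; split; rewrite /path_rev ?subr0 ?subrr//.
apply: (@within_comp R R T _ `[0, 1] (fun t => 1 - t) u cu) => [|t].
  apply: continuous_subspaceT => t; apply: cvgB; [exact: cvg_cst|exact: cvg_id].
by rewrite /= !in_itv/= => /andP[? ?]; lra.
Qed.

Lemma path_cst x : is_path x x (cst x).
Proof. by split => //; apply: continuous_subspaceT; exact: cst_continuous. Qed.

Lemma homotopic_reparam u (p q : R -> R) : {within `[0, 1], continuous u} ->
  continuous p -> continuous q ->
  (forall t, 0 <= t <= 1 -> 0 <= p t <= 1 /\ 0 <= q t <= 1) ->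
  p 0 = q 0 -> p 1 = q 1 -> homotopic (u \o p) (u \o q).
Proof.
move=> cu cp cq pq pq0 pq1.
exists (u \o (fun st => (1 - st.1) * p st.2 + st.1 * q st.2)); split => /=.
- apply: (@within_comp (R * R)%type R T _ `[0, 1] (fun st => (1 - st.1) * p st.2 + st.1 * q st.2) u cu) => [|[s t]].
    apply: continuous_subspaceT => -[s t]; apply: cvgD; apply: cvgM.
    + by apply: cvgB; [exact: cvg_cst|exact: cvg_fst].
    + by apply: (@continuous_comp _ _ _ (@snd R R) p); [exact: cvg_snd|exact: cp].
    + exact: cvg_fst.
    + by apply: (@continuous_comp _ _ _ (@snd R R) q); [exact: cvg_snd|exact: cq].
  rewrite -/sq sqE /= in_itv/= => /andP[/andP[s0 s1] /pq[/andP[? ?] /andP[? ?]]].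
  by apply/andP; split; nra.
- by move=> t _; rewrite subr0 subrr !mul1r !mul0r addr0 add0r.
- move=> s _; rewrite pq0 pq1; split; congr u; ring.
Qed.

Lemma eq_homotopic u v : {within `[0, 1], continuous u} ->
  (forall t, 0 <= t <= 1 -> u t = v t) -> homotopic u v.
Proof.
move=> cu uv; exists (u \o snd); split => //.
- apply: (@within_comp (R * R)%type R T _ `[0, 1] snd u cu) => [|[s t] []//].
  by apply: continuous_subspaceT => ?; exact: cvg_snd.
- by move=> t t01 /=; rewrite uv.
Qed.

Lemma homotopic_refl u : {within `[0, 1], continuous u} -> homotopic u u.
Proof. by move=> cu; exact: eq_homotopic. Qed.

Lemma homotopic_sym u v : homotopic u v -> homotopic v u.
Proof.
move=> [H [cH H0 H1]]; exists (H \o (fun st => (1 - st.1, st.2))); split.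
- apply: (@within_comp (R * R)%type (R * R)%type T _ sq (fun st => (1 - st.1, st.2)) H cH) => [|[s t]].
    apply: continuous_subspaceT; apply: continuous_pair => st; last exact: cvg_snd.
    by apply: cvgB; [exact: cvg_cst|exact: cvg_fst].
  by rewrite -/sq /= !sqE => /andP[/andP[? ?] ->]; rewrite andbT; lra.
- by move=> t /H0[] /=; rewrite subr0 subrr.
- move=> s s01 /=; have /H1[-> ->] : 0 <= 1 - s <= 1 by lra.
  have [|_ <-] := H0 0; first by rewrite lexx ler01.
  have [|_ <-] := H0 1; first by rewrite lexx ler01.
  by have [|-> ->] := H1 1; first by rewrite lexx ler01.
Qed.

Lemma homotopic_trans v u w : homotopic u v -> homotopic v w -> homotopic u w.
Proof.
move=> [H [cH H0 H1]] [K [cK K0 K1]].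
have [u0 u1] : v 0 = u 0 /\ v 1 = u 1.
  have [|_ <-] := H0 0; first by rewrite lexx ler01.
  have [|_ <-] := H0 1; first by rewrite lexx ler01.
  by have [|-> ->] := H1 1; first by rewrite lexx ler01.
exists (fun st => if st.1 <= 2^-1 then H (2 * st.1, st.2)
                  else K (2 * st.1 - 1, st.2)); split.
- apply: (@within_paste _ _ _ _ fst 2^-1 _ (H \o (fun st => (2 * st.1, st.2)))
    (K \o (fun st => (2 * st.1 - 1, st.2)))) => //.
  + by move=> ?; exact: cvg_fst.
  + apply: (@within_comp (R * R)%type (R * R)%type T _ sq (fun st => (2 * st.1, st.2)) H cH) => [|[s t]].
      apply: continuous_subspaceT; apply: continuous_pair => st; last exact: cvg_snd.
      by apply: cvgM; [exact: cvg_cst|exact: cvg_fst].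
    by rewrite -/sq /= => -[]; rewrite !sqE => /andP[/andP[? ?] ->] ?; rewrite andbT; lra.
  + apply: (@within_comp (R * R)%type (R * R)%type T _ sq (fun st => (2 * st.1 - 1, st.2)) K cK) => [|[s t]].
      apply: continuous_subspaceT; apply: continuous_pair => st; last exact: cvg_snd.
      apply: cvgB; last exact: cvg_cst.
      by apply: cvgM; [exact: cvg_cst|exact: cvg_fst].
    by rewrite -/sq /= => -[]; rewrite !sqE => /andP[/andP[? ?] ->] ?; rewrite andbT; lra.
  + by move=> [s t] _ /= ->.
  + move=> [s t]; rewrite -/sq sqE /= => /andP[_ t01].
    rewrite le_eqVlt => /predU1P[<-|s2]; last by rewrite leNgt s2.
    rewrite lexx mulfV// subrr; have [_ ->] := H0 _ t01.
    by have [-> _] := K0 _ t01.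
- move=> t t01 /=; rewrite invr_ge0 ler0n mulr0 (H0 _ t01).1 ifF.
    by rewrite mulr1 (_ : 2 - 1 = 1 :> R) ?(K0 _ t01).2//; lra.
  by apply/negbTE; rewrite -ltNge; lra.
- move=> s s01 /=; case: leP => s2.
    by apply: H1; lra.
  by rewrite -u0 -u1; apply: K1; lra.
Qed.

Lemma homotopic_concat u u' v v' : u 1 = v 0 ->
  homotopic u u' -> homotopic v v' ->
  homotopic (path_concat u v) (path_concat u' v').
Proof.
move=> uv [H [cH H0 H1]] [K [cK K0 K1]].
exists (fun st => if st.2 <= 2^-1 then H (st.1, 2 * st.2)
                  else K (st.1, 2 * st.2 - 1)); split.
- apply: (@within_paste _ _ _ _ snd 2^-1 _ (H \o (fun st => (st.1, 2 * st.2)))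
    (K \o (fun st => (st.1, 2 * st.2 - 1)))) => //.
  + by move=> ?; exact: cvg_snd.
  + apply: (@within_comp (R * R)%type (R * R)%type T _ sq (fun st => (st.1, 2 * st.2)) H cH) => [|[s t]].
      apply: continuous_subspaceT; apply: continuous_pair => st; first exact: cvg_fst.
      by apply: cvgM; [exact: cvg_cst|exact: cvg_snd].
    by rewrite -/sq /= => -[]; rewrite !sqE => /andP[-> /andP[? ?]] ?; lra.
  + apply: (@within_comp (R * R)%type (R * R)%type T _ sq (fun st => (st.1, 2 * st.2 - 1)) K cK) => [|[s t]].
      apply: continuous_subspaceT; apply: continuous_pair => st; first exact: cvg_fst.
      apply: cvgB; last exact: cvg_cst.
      by apply: cvgM; [exact: cvg_cst|exact: cvg_snd].
    by rewrite -/sq /= => -[]; rewrite !sqE => /andP[-> /andP[? ?]] ?; lra.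
  + by move=> [s t] _ /= ->.
  + move=> [s t]; rewrite -/sq sqE /= => /andP[s01 _].
    rewrite le_eqVlt => /predU1P[<-|s2]; last by rewrite leNgt s2.
    rewrite lexx mulfV// subrr; have [_ ->] := H1 _ s01.
    by have [-> _] := K1 _ s01.
- move=> t t01 /=; rewrite /path_concat; case: leP => t2.
    by apply: H0; lra.
  by apply: K0; lra.
- move=> s s01 /=; rewrite /path_concat.
  have -> : (1 <= 2^-1 :> R) = false by apply/negbTE; rewrite -ltNge; lra.
  rewrite invr_ge0 ler0n mulr0 mulr1 (_ : 2 - 1 = 1 :> R); last by lra.
  by rewrite (H1 _ s01).1 (K1 _ s01).2.
Qed.

End Paths.

Section PathAlgebra.
Context {R : realType} {T : topologicalType}.
Implicit Types (x y : T) (u v w : R -> T).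

Lemma continuous_affine (a b : R) : continuous (fun t : R => a * t + b).
Proof.
by move=> t; apply: cvgD; [exact: mulrl_continuous|exact: cvg_cst].
Qed.

Lemma continuous_minr (p q : R -> R) :
  continuous p -> continuous q -> continuous (fun t => Num.min (p t) (q t)).
Proof. by move=> cp cq t; by apply: continuous_min; [exact: cp|exact: cq]. Qed.

Lemma continuous_maxr (p q : R -> R) :
  continuous p -> continuous q -> continuous (fun t => Num.max (p t) (q t)).
Proof. by move=> cp cq t; apply: continuous_max; [exact: cp|exact: cq]. Qed.

Lemma path_concatl u v t : t <= 2^-1 -> path_concat u v t = u (2 * t).
Proof. by rewrite /path_concat => ->. Qed.

Lemma path_concatr u v t : 2^-1 < t -> path_concat u v t = v (2 * t - 1).
Proof. by rewrite /path_concat leNgt => ->. Qed.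

Lemma homotopic_reparam_eq u v (p : R -> R) : {within `[0, 1], continuous u} ->
  continuous p -> p 0 = 0 -> p 1 = 1 ->
  (forall t, 0 <= t <= 1 -> 0 <= p t <= 1 /\ v t = u (p t)) ->
  homotopic u v.
Proof.
move=> cu cp p0 p1 pv.
apply: (@homotopic_trans _ _ (u \o p)); last first.
  apply: eq_homotopic => [|t /pv[_ ->]//].
  apply: (@within_comp R R T _ `[0, 1] p u cu); first exact: continuous_subspaceT.
  by move=> t; rewrite /= !in_itv/= => /pv[].
apply: (@homotopic_reparam _ _ u id p) => //; first by move=> ?; exact: cvg_id.
by move=> t t01; split => //; have [] := pv _ t01.
Qed.

Lemma homotopic_concatA x y z z' u v w :
  is_path x y u -> is_path y z v -> is_path z z' w ->
  homotopic (path_concat u (path_concat v w)) (path_concat (path_concat u v) w).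
Proof.
move=> pu pv pw; have [c _ _] := path_concat_path pu (path_concat_path pv pw).
pose p (t : R) :=
  Num.min (2 * t + 0) (Num.min (1 * t + 4^-1) (2^-1 * t + 2^-1)).
apply: (@homotopic_reparam_eq _ _ p) => //.
- by apply: continuous_minr; last apply: continuous_minr;
    exact: continuous_affine.
- by rewrite /p !mulr0 !add0r min_l// le_min; lra.
- by rewrite /p min_r ?min_r; lra.
move=> t /andP[t0 t1].
have [t4|t4] := leP t 4^-1.
  have -> : p t = 2 * t by rewrite /p min_l ?addr0// le_min; apply/andP; split; lra.
  split; first by lra.
  by rewrite !path_concatl//; lra.
have [t2|t2] := leP t 2^-1.
  have -> : p t = t + 4^-1.
    by rewrite /p (min_l (x := 1 * t + _)) ?min_r ?mul1r//; lra.
  split; first by lra.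
  rewrite path_concatl// path_concatr; last by lra.
  rewrite path_concatr; last by lra.
  by rewrite path_concatl; [congr v; lra|lra].
have -> : p t = 2^-1 * t + 2^-1.
  by rewrite /p (min_r (x := 1 * t + _)) ?min_r//; lra.
split; first by lra.
rewrite !path_concatr; first by congr w; lra.
all: lra.
Qed.

Lemma homotopic_concat1p x y u :
  is_path x y u -> homotopic u (path_concat (cst x) u).
Proof.
move=> [cu u0 u1].
apply: (@homotopic_reparam_eq _ _ (fun t => Num.max 0 (2 * t + (-1)))) => //.
- apply: continuous_maxr; [by move=> ?; exact: cvg_cst|exact: continuous_affine].
- by rewrite max_l//; lra.
- by rewrite max_r; lra.
move=> t /andP[t0 t1]; have [t2|t2] := leP t 2^-1.
  rewrite max_l; last by lra.
  by rewrite lexx ler01 path_concatl// u0.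
rewrite max_r; last by lra.
by split; [lra|rewrite path_concatr].
Qed.

Lemma homotopic_concatp1 x y u :
  is_path x y u -> homotopic u (path_concat u (cst y)).
Proof.
move=> [cu u0 u1].
apply: (@homotopic_reparam_eq _ _ (fun t => Num.min (2 * t + 0) 1)) => //.
- apply: continuous_minr; [exact: continuous_affine|by move=> ?; exact: cvg_cst].
- by rewrite min_l; lra.
- by rewrite min_r; lra.
move=> t /andP[t0 t1]; rewrite addr0; have [t2|t2] := leP t 2^-1.
  rewrite min_l; last by lra.
  by split; [lra|rewrite path_concatl].
rewrite min_r; last by lra.
by rewrite lexx ler01 path_concatr// u1.
Qed.

Lemma homotopic_concatpV x y u :
  is_path x y u -> homotopic (cst x) (path_concat u (path_rev u)).
Proof.
move=> [cu u0 u1].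
pose p (t : R) := Num.min (2 * t + 0) (-2 * t + 2).
have cp : continuous p by apply: continuous_minr; exact: continuous_affine.
have c0 : continuous (cst 0 : R -> R) by move=> ?; exact: cvg_cst.
have p01 t : 0 <= t <= 1 -> 0 <= p t <= 1.
  move=> /andP[t0 t1]; rewrite /p le_min ge_min; apply/andP; split; first by lra.
  by have [?|?] := leP t 2^-1; apply/orP; [left|right]; lra.
apply: (@homotopic_trans _ _ (u \o p)).
  have -> : (cst x : R -> T) = u \o cst (0 : R) by apply/funext => t /=; rewrite u0.
  apply: homotopic_reparam => //.
  - by move=> t t01; split; [rewrite lexx ler01|exact: p01].
  - by rewrite /p min_l /=; lra.
  - by rewrite /p min_r /=; lra.
apply: eq_homotopic => [|t /andP[t0 t1] /=].
  apply: (@within_comp R R T _ `[0, 1] p u cu); first exact: continuous_subspaceT.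
  by move=> t; rewrite /= !in_itv/=; exact: p01.
rewrite /p; have [t2|t2] := leP t 2^-1.
  by rewrite path_concatl// min_l ?addr0//; lra.
by rewrite path_concatr// /path_rev min_r; [congr u; lra|lra].
Qed.

Lemma homotopic_concatVp x y u :
  is_path x y u -> homotopic (cst y) (path_concat (path_rev u) u).
Proof.
move=> pu; have := homotopic_concatpV (path_rev_path pu).
by have -> : path_rev (path_rev u) = u by
  apply/funext => t; rewrite /path_rev; congr u; lra.
Qed.

Lemma homotopic_rev u v : homotopic u v -> homotopic (path_rev u) (path_rev v).
Proof.
move=> [H [cH H0 H1]]; exists (H \o (fun st => (st.1, 1 - st.2))); split.
- apply: (@within_comp (R * R)%type (R * R)%type T _ (`[0, 1] `*` `[0, 1])
    (fun st => (st.1, 1 - st.2)) H cH) => [|[s t] []].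
    apply: continuous_subspaceT; apply: continuous_pair => st; first exact: cvg_fst.
    by apply: cvgB; [exact: cvg_cst|exact: cvg_snd].
  by rewrite /= !in_itv/= => -> /andP[? ?]; split => //; lra.
- by move=> t t01; apply: (H0 (1 - t)); lra.
- by move=> s s01 /=; rewrite /path_rev !subr0 !subrr; have [-> ->] := H1 _ s01.
Qed.

End PathAlgebra.

Section FundamentalGroup.
Context (R : realType) (X : topologicalType) (x0 : X).

Record loop := Loop {
  loop_fun :> R -> X;
  loop_path : is_path x0 x0 loop_fun }.

HB.instance Definition _ := gen_eqMixin loop.
HB.instance Definition _ := gen_choiceMixin loop.

Definition loop_rel (a b : loop) : bool := `[< homotopic a b >].

Let loop_cont (a : loop) : {within `[0, 1], continuous a}.
Proof. by have [] := loop_path a. Qed.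

Lemma loop_rel_refl : reflexive loop_rel.
Proof. by move=> a; apply/asboolP; apply: homotopic_refl. Qed.

Lemma loop_rel_sym : symmetric loop_rel.
Proof. by move=> a b; apply/asboolP/asboolP; exact: homotopic_sym. Qed.

Lemma loop_rel_trans : transitive loop_rel.
Proof.
by move=> b a c /asboolP ab /asboolP bc; apply/asboolP; exact: homotopic_trans bc.
Qed.

Canonical loop_equiv := EquivRel loop_rel loop_rel_refl loop_rel_sym loop_rel_trans.

Definition pi1 := {eq_quot loop_rel}.
HB.instance Definition _ := Choice.on pi1.
HB.instance Definition _ := EqQuotient.on pi1.

Definition loop_class (a : loop) : pi1 := \pi_pi1 a.

Lemma pi1P (a b : loop) : \pi_pi1 a = \pi_pi1 b <-> homotopic a b.
Proof.
split=> [/eqmodP|ab]; first by move/asboolP.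
by apply/eqmodP/asboolP.
Qed.

Lemma homotopic_repr (a : loop) : homotopic (repr (\pi_pi1 a)) a.
Proof. by apply/pi1P; rewrite reprK. Qed.

Definition loop_mul (a b : loop) := Loop (path_concat_path (loop_path a) (loop_path b)).
Definition loop_inv (a : loop) := Loop (path_rev_path (loop_path a)).
Definition loop_one := Loop (path_cst x0).

Definition pi1_mul (g h : pi1) : pi1 := \pi_pi1 (loop_mul (repr g) (repr h)).
Definition pi1_inv (g : pi1) : pi1 := \pi_pi1 (loop_inv (repr g)).
Definition pi1_one : pi1 := \pi_pi1 loop_one.

Lemma pi1_mulE a b : pi1_mul (\pi_pi1 a) (\pi_pi1 b) = \pi_pi1 (loop_mul a b).
Proof.
apply/pi1P/homotopic_concat; [|exact: homotopic_repr|exact: homotopic_repr].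
have [_ _ ->] := loop_path (repr (\pi_pi1 a)).
by have [_ ->] := loop_path (repr (\pi_pi1 b)).
Qed.

Lemma pi1_invE a : pi1_inv (\pi_pi1 a) = \pi_pi1 (loop_inv a).
Proof. by apply/pi1P; apply: homotopic_rev; exact: homotopic_repr. Qed.

Lemma pi1_mulA : associative pi1_mul.
Proof.
elim/quotW => a; elim/quotW => b; elim/quotW => c.
rewrite (pi1_mulE b) (pi1_mulE a) (pi1_mulE a b) (pi1_mulE (loop_mul a b)).
apply/pi1P; exact: homotopic_concatA (loop_path a) (loop_path b) (loop_path c).
Qed.

Lemma pi1_mul1 : left_id pi1_one pi1_mul.
Proof.
elim/quotW => a; rewrite pi1_mulE; apply/esym/pi1P.
exact: homotopic_concat1p (loop_path a).
Qed.

Lemma pi1_1mul : right_id pi1_one pi1_mul.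
Proof.
elim/quotW => a; rewrite pi1_mulE; apply/esym/pi1P.
exact: homotopic_concatp1 (loop_path a).
Qed.

Lemma pi1_mulV : left_inverse pi1_one pi1_inv pi1_mul.
Proof.
elim/quotW => a; rewrite (pi1_invE a) pi1_mulE; apply/esym/pi1P.
exact: homotopic_concatVp (loop_path a).
Qed.

Lemma pi1_Vmul : right_inverse pi1_one pi1_inv pi1_mul.
Proof.
elim/quotW => a; rewrite (pi1_invE a) pi1_mulE; apply/esym/pi1P.
exact: homotopic_concatpV (loop_path a).
Qed.

HB.instance Definition _ :=
  isGroup.Build pi1 pi1_mulA pi1_mul1 pi1_1mul pi1_mulV pi1_Vmul.

End FundamentalGroup.

Section QuotientGroup.
Local Open Scope group_scope.
Context (G : groupType).

Record normal_subgroup := NormalSubgroup {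
  nsub_set :> set G;
  nsub1 : nsub_set 1;
  nsubM : forall x y, nsub_set x -> nsub_set y -> nsub_set (x * y);
  nsubV : forall x, nsub_set x -> nsub_set x^-1;
  nsubJ : forall x g, nsub_set x -> nsub_set (x ^ g) }.

Variable N : normal_subgroup.

Definition coset_rel (x y : G) : bool := `[< nsub_set N (x^-1 * y) >].

Lemma coset_rel_refl : reflexive coset_rel.
Proof. by move=> x; apply/asboolP; rewrite mulVg; exact: nsub1. Qed.

Lemma coset_rel_sym : symmetric coset_rel.
Proof.
by move=> x y; apply/asboolP/asboolP => /nsubV; rewrite invgM invgK.
Qed.

Lemma coset_rel_trans : transitive coset_rel.
Proof.
move=> y x z /asboolP xy /asboolP yz; apply/asboolP.
by have := nsubM xy yz; rewrite -mulgA mulVKg.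
Qed.

Canonical coset_equiv :=
  EquivRel coset_rel coset_rel_refl coset_rel_sym coset_rel_trans.

Definition quotient_group := {eq_quot coset_rel}.
HB.instance Definition _ := Choice.on quotient_group.
HB.instance Definition _ := EqQuotient.on quotient_group.

Definition coset (x : G) : quotient_group := \pi_quotient_group x.

Lemma coset_eqP x y : coset x = coset y <-> nsub_set N (x^-1 * y).
Proof.
by split=> [/eqmodP/asboolP//|xy]; apply/eqmodP/asboolP.
Qed.

Lemma coset_repr (x : quotient_group) : coset (repr x) = x.
Proof. exact: reprK. Qed.

Definition quotient_mul (x y : quotient_group) := coset (repr x * repr y).
Definition quotient_inv (x : quotient_group) := coset (repr x)^-1.

Lemma quotient_mulE x y : quotient_mul (coset x) (coset y) = coset (x * y).
Proof.
have /coset_eqP := coset_repr (coset x); have /coset_eqP := coset_repr (coset y).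
rewrite /quotient_mul; move: (repr _) (repr _) => x' y' Ny Nx; apply/coset_eqP.
have := nsubM (nsubJ y' Nx) Ny.
by rewrite invgM conjgE -!mulgA mulVKg.
Qed.

Lemma quotient_invE x : quotient_inv (coset x) = coset x^-1.
Proof.
have /coset_eqP := coset_repr (coset x); rewrite /quotient_inv.
move: (repr _) => x' Nx; apply/coset_eqP; rewrite invgK.
by have := nsubJ x'^-1 (nsubV Nx); rewrite conjgE invgM !invgK mulgK.
Qed.

Lemma quotient_mulA : associative quotient_mul.
Proof.
elim/quotW => x; elim/quotW => y; elim/quotW => z.
by rewrite -!/(coset _) !quotient_mulE mulgA.
Qed.

Lemma quotient_mul1g : left_id (coset 1) quotient_mul.
Proof. by elim/quotW => x; rewrite -!/(coset _) quotient_mulE mul1g. Qed.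

Lemma quotient_mulg1 : right_id (coset 1) quotient_mul.
Proof. by elim/quotW => x; rewrite -!/(coset _) quotient_mulE mulg1. Qed.

Lemma quotient_mulVg : left_inverse (coset 1) quotient_inv quotient_mul.
Proof.
by elim/quotW => x; rewrite -!/(coset _) quotient_invE quotient_mulE mulVg.
Qed.

Lemma quotient_mulgV : right_inverse (coset 1) quotient_inv quotient_mul.
Proof.
by elim/quotW => x; rewrite -!/(coset _) quotient_invE quotient_mulE mulgV.
Qed.

HB.instance Definition _ := isGroup.Build quotient_group
  quotient_mulA quotient_mul1g quotient_mulg1 quotient_mulVg quotient_mulgV.

Lemma cosetM : {morph coset : x y / x * y}.
Proof. by move=> x y; rewrite [RHS]quotient_mulE. Qed.

Lemma cosetF : {morph coset : x y / x / y}.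
Proof. by move=> x y; rewrite cosetM; congr (_ * _); rewrite [RHS]quotient_invE. Qed.

HB.instance Definition _ := isGroupMorphism.Build G quotient_group coset cosetF.

Definition subgroup_index : nat := #|` fset_set [set: quotient_group]|.

End QuotientGroup.

Notation group_end G := (UMagmaMorphism.type G G).

Section Reidemeister.
Local Open Scope group_scope.
Context (G : groupType) (phi : group_end G).

Definition twisted_conj (a b : G) : bool :=
  `[< exists g, b = g * a * (phi g)^-1 >].

Lemma twisted_conj_refl : reflexive twisted_conj.
Proof. by move=> a; apply/asboolP; exists 1; rewrite gmulf1 invg1 mul1g mulg1. Qed.

Lemma twisted_conj_sym : symmetric twisted_conj.
Proof.
by move=> a b; apply/asboolP/asboolP => -[g ->]; exists g^-1;
  rewrite gmulfV invgK !mulgA mulVg mul1g mulgVK.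
Qed.

Lemma twisted_conj_trans : transitive twisted_conj.
Proof.
move=> b a c /asboolP[g ->] /asboolP[h ->]; apply/asboolP; exists (h * g).
by rewrite gmulfM invgM !mulgA.
Qed.

Canonical twisted_conj_equiv := EquivRel twisted_conj
  twisted_conj_refl twisted_conj_sym twisted_conj_trans.

Definition reidemeister_set := {eq_quot twisted_conj}.
HB.instance Definition _ := Choice.on reidemeister_set.
HB.instance Definition _ := EqQuotient.on reidemeister_set.

Definition reidemeister_class (a : G) : reidemeister_set := \pi_reidemeister_set a.

Lemma reidemeister_classP a b :
  reidemeister_class a = reidemeister_class b <->
  exists g, b = g * a * (phi g)^-1.
Proof.
by split=> [/eqmodP/asboolP//|ab]; apply/eqmodP/asboolP.
Qed.

Record finite_observer := FiniteObserver {
  observer_normal :> normal_subgroup G;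
  observer_finite : finite_set [set: quotient_group observer_normal];
  observer_stable : phi @` nsub_set observer_normal `<=` nsub_set observer_normal }.

End Reidemeister.

Section Observers.
Local Open Scope group_scope.
Context (G : groupType) (phi : group_end G).

Section Observer.
Variable N : finite_observer phi.

(* The endomorphism of G / N induced by phi: see induced_endE. *)
Definition induced_end (x : quotient_group N) : quotient_group N :=
  coset N (phi (repr x)).

Lemma induced_endE x : induced_end (coset N x) = coset N (phi x).
Proof.
have /coset_eqP := coset_repr (coset N x); rewrite /induced_end.
move: (repr _) => x' Nx; apply/coset_eqP; rewrite -gmulfV -gmulfM.
by apply: (observer_stable (f := N)); exists (x'^-1 * x).
Qed.

Lemma induced_endF : {morph induced_end : x y / x / y}.
Proof.
elim/quotW => x; elim/quotW => y; rewrite -!/(coset _ _) -gmulfF !induced_endE.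
by rewrite !gmulfF.
Qed.

HB.instance Definition _ := isGroupMorphism.Build
  (quotient_group N) (quotient_group N) induced_end induced_endF.

(* The map [a] |-> [coset N a]: see reidemeister_projE. *)
Definition reidemeister_proj (alpha : reidemeister_set phi) :
    reidemeister_set induced_end :=
  reidemeister_class induced_end (coset N (repr alpha)).

Lemma reidemeister_projE a :
  reidemeister_proj (reidemeister_class phi a) =
  reidemeister_class induced_end (coset N a).
Proof.
have : reidemeister_class phi a = reidemeister_class phi (repr (reidemeister_class phi a)).
  by rewrite [RHS]reprK.
move=> /reidemeister_classP[g ag]; apply/esym/reidemeister_classP.
by exists (coset N g); rewrite ag !cosetM gmulfV; congr (_ * _^-1); exact/esym/induced_endE.
Qed.

End Observer.
End Observers.

(* Elements of Z[S] are given by their coefficient functions S -> int.  The sums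
   below are finitely supported sums: they have their intended meaning for
   functions with finite support, which the Reidemeister trace of a self-map of
   a finite complex has. *)
Section Chains.

Definition l1norm (S : choiceType) (c : S -> int) : int :=
  \sum_(s \in [set: S]) `|c s|.

Definition pushforward (S T : choiceType) (h : S -> T) (c : S -> int) : T -> int :=
  fun t => \sum_(s \in h @^-1` [set t]) c s.

End Chains.

(* The maximum of A; 0 if A has none. *)
Definition maxZ (A : set int) : int := xget 0 (A `&` ubound A).

(* The minimum of A, in N with +oo adjoined; +oo if A is empty. *)
Definition min_infty (A : set nat) : \bar int :=
  xget +oo%E [set (n%:Z)%:E%E | n in A `&` lbound A].

Section ObserverInvariants.
Context (G : groupType) (phi : group_end G) (rt : reidemeister_set phi -> int).

Definition observed_trace (N : finite_observer phi) :
    reidemeister_set (@induced_end G phi N) -> int :=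
  pushforward (@reidemeister_proj G phi N) rt.
Arguments observed_trace : clear implicits.

Definition trace_support : set (reidemeister_set phi) := [set alpha | rt alpha != 0].

Definition nielsen_number : nat := #|` fset_set trace_support|.

Definition lefschetz_number : int := \sum_(alpha \in [set: reidemeister_set phi]) rt alpha.

Definition observed_mass (N : finite_observer phi) : int := l1norm (observed_trace N).

Definition mass_profile (B : nat) : int :=
  maxZ [set observed_mass N | N in [set N : finite_observer phi | (subgroup_index N <= B)%N]].

Definition min_index (P : finite_observer phi -> Prop) : \bar int :=
  min_infty [set subgroup_index N | N in [set N : finite_observer phi | P N]].

Definition dc : \bar int := min_index (fun N => observed_trace N <> cst 0).

Definition cfc : \bar int := min_index (fun N => observed_mass N = l1norm rt).

Definition oc : \bar int :=
  min_index (fun N => set_inj trace_support (@reidemeister_proj G phi N)).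

End ObserverInvariants.

Arguments observed_trace {G phi} rt N _ : assert.

Section CWComplex.
Context (R : realType).

Definition sqnorm n (v : 'rV[R]_n) : R := \sum_(i < n) v ord0 i ^+ 2.

Definition disk n : set 'rV[R]_n := [set v | sqnorm v <= 1].
Definition open_disk n : set 'rV[R]_n := [set v | sqnorm v < 1].
Definition sphere n : set 'rV[R]_n := [set v | sqnorm v = 1].

(* For finitely many cells in a Hausdorff space, closure-finiteness and the weak
   topology are automatic, so these are all the axioms of a finite CW complex. *)
Record finite_cw_complex (X : topologicalType) := FiniteCW {
  cell : finType;
  cell_dim : cell -> nat;
  char_map : forall e : cell, 'rV[R]_(cell_dim e) -> X;
  open_cell := fun e => @char_map e @` @open_disk (cell_dim e);
  cw_hausdorff : hausdorff_space X;
  cw_continuous : forall e, {within @disk (cell_dim e), continuous (@char_map e)};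
  cw_injective : forall e, set_inj (@open_disk (cell_dim e)) (@char_map e);
  cw_disjoint : trivIset setT open_cell;
  cw_cover : \bigcup_(e in setT) open_cell e = setT;
  cw_boundary : forall e, @char_map e @` @sphere (cell_dim e) `<=`
    \bigcup_(e' in [set e' | (cell_dim e' < cell_dim e)%N]) open_cell e' }.

Definition skeleton X (K : finite_cw_complex X) (k : nat) : set X :=
  \bigcup_(e in [set e : cell K | (cell_dim e <= k)%N]) open_cell e.

Definition cellular X (K : finite_cw_complex X) (f : X -> X) : Prop :=
  continuous f /\ forall k, f @` skeleton K k `<=` skeleton K k.

End CWComplex.

Section FixedPointIndex.
Context (R : realType).

Definition C1 n (h : 'rV[R]_n -> 'rV[R]_n) : Prop :=
  (forall x, differentiable h x) /\ continuous (fun x => 'J h x).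

(* k is the Brouwer degree at 0 of u on the bounded open set W, where u is
   continuous on closure W without zeros on the boundary closure W `\` W: it is
   the sum of the signs of the Jacobian determinants at the zeros of any C1 map
   h for which 0 is a regular value and that is closer to u on closure W than
   the distance from 0 to the image under u of the boundary. *)
Definition is_brouwer_degree n (u : 'rV[R]_n -> 'rV[R]_n) (W : set 'rV[R]_n)
    (k : int) : Prop :=
  forall h : 'rV[R]_n -> 'rV[R]_n, C1 h ->
    (forall x, W x -> h x = 0 -> 'J h x \in unitmx) ->
    (forall x y, closure W x -> (closure W `\` W) y -> `|h x - u x| < `|u y|) ->
    k = \sum_(x \in W `&` [set x | h x = 0]) sgz (\det ('J h x)).

Definition fixed_points (T : Type) (f : T -> T) : set T := [set x | f x = x].

(* The index of an isolated set F of fixed points of a self-map f of a compact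
   ENR X: embed X by j as a retract, by r, of an open set O of R^n, and take the
   degree of id - j f r on a neighbourhood W of j F whose closure contains no
   other fixed point of j f r (the fixed points of j f r are the images by j of
   those of f).  Every finite CW complex is such an X, and the resulting integer
   depends neither on (n, O, j, r) nor on W. *)
Definition is_fixed_point_index (X : topologicalType) (f : X -> X) (F : set X)
    (k : int) : Prop :=
  exists n (O : set 'rV[R]_n) (j : X -> 'rV[R]_n) (r : 'rV[R]_n -> X),
    [/\ open O /\ range j `<=` O, continuous j, {within O, continuous r},
        cancel j r
      & forall W : set 'rV[R]_n, open W -> bounded_set W -> closure W `<=` O ->
          j @` F `<=` W -> closure W `&` j @` fixed_points f `<=` j @` F ->
          is_brouwer_degree (fun x => x - j (f (r x))) W k].

Definition fixed_point_index (X : topologicalType) (f : X -> X) (F : set X) : int :=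
  xget 0 [set k | is_fixed_point_index f F k].

End FixedPointIndex.

Section UniversalCover.
Context (R : realType) (X Xt : topologicalType) (p : Xt -> X).

Definition evenly_covered (U : set X) : Prop :=
  exists S : set (set Xt),
    [/\ trivIset S id, p @^-1` U = \bigcup_(V in S) V
      & forall V, S V -> [/\ open V, set_bij V U p
          & forall V', open V' -> V' `<=` V -> open (p @` V')]].

Definition covering_map : Prop :=
  [/\ continuous p, range p = setT
    & forall x, exists2 U, open_nbhs x U & evenly_covered U].

Definition simply_connected : Prop :=
  (forall x y : Xt, exists u : R -> Xt, is_path x y u) /\
  (forall (x : Xt) (u : R -> Xt), is_path x x u -> homotopic u (cst x)).

Definition universal_cover : Prop := covering_map /\ simply_connected.

(* The left action of pi1 on the universal cover by deck transformations,
   normalized by the base point xt0 over x0: the class of a loop a moves xt0 to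
   the endpoint of the lift of a that starts at xt0. *)
Definition deck_action (x0 : X) (xt0 : Xt) (act : pi1 R x0 -> Xt -> Xt) : Prop :=
  [/\ p xt0 = x0,
      (forall x, act 1%g x = x) /\
      (forall g h x, act (g * h)%g x = act g (act h x)),
      forall g, continuous (act g),
      forall g x, p (act g x) = p x
    & forall (a : loop R x0) (u : R -> Xt),
        {within `[0, 1], continuous u} -> u 0 = xt0 ->
        (forall t, 0 <= t <= 1 -> p (u t) = a t) ->
        act (loop_class a) xt0 = u 1].

End UniversalCover.

Section ReidemeisterTrace.
Context (R : realType) (X Xt : topologicalType) (x0 : X) (p : Xt -> X).
Context (act : pi1 R x0 -> Xt -> Xt) (f : X -> X) (ft : Xt -> Xt).

Definition fixed_point_class (a : pi1 R x0) : set X :=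
  p @` fixed_points (act a \o ft).

(* The fixed-point class does not depend on the representative of alpha: see
   fixed_point_class_twisted_conj. *)
Definition reidemeister_trace (phi : group_end (pi1 R x0)) :
    reidemeister_set phi -> int :=
  fun alpha => fixed_point_index R f (fixed_point_class (repr alpha)).

Lemma fixed_point_class_twisted_conj (phi : group_end (pi1 R x0)) (xt0 : Xt) :
  deck_action p xt0 act -> (forall g x, ft (act g x) = act (phi g) (ft x)) ->
  forall a g, fixed_point_class (g * a * (phi g)^-1)%g = fixed_point_class a.
Proof.
move=> [_ [act1 actM] _ pact _] ftE.
have sub a g : fixed_point_class (g * a * (phi g)^-1)%g `<=` fixed_point_class a.
  move=> _ [x xE <-]; exists (act g^-1%g x); last exact: pact.
  rewrite /fixed_points/= in xE *; rewrite ftE gmulfV -[in RHS]xE -!actM.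
  by congr act; rewrite !mulgA mulVg mul1g.
move=> a g; apply/seteqP; split; first exact: (sub a g).
have := sub (g * a * (phi g)^-1)%g g^-1%g.
by rewrite gmulfV invgK !mulgA mulVg mul1g mulgVK.
Qed.

End ReidemeisterTrace.

Arguments reidemeister_trace {R X Xt x0} p act f ft phi _ : assert.

(* Main.v *)
(* The observed trace of N is the pushforward of RT(f), so the triangle
   inequality bounds its mass by that of RT(f), with equality when the projection
   is injective on the support; at index 1 the target is a single class and the
   mass is |L(f)|. All six claims follow from this once RT(f) is known to have
   finite support. For the latter, lifting paths shows that pi_1 acts freely and
   transitively on the fibres of the universal cover; hence a point of X has a
   neighbourhood meeting at most one fixed-point class, and by compactness of X
   only finitely many classes are nonempty. An empty class has index 0, as seen
   by evaluating the degree on the empty neighbourhood. *)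

Require Import Defs.
From mathcomp Require Import all_boot all_order all_algebra finmap.
From mathcomp Require Import all_classical all_reals all_analysis lra.

Set Implicit Arguments.
Unset Strict Implicit.
Unset Printing Implicit Defensive.

Import Order.TTheory GRing.Theory Num.Theory.
Import numFieldTopology.Exports numFieldNormedType.Exports.

Local Open Scope classical_set_scope.
Local Open Scope ring_scope.

(** * Finitely supported chains *)

Section Pushforward.
Local Open Scope fset_scope.
Context (S : choiceType) (c : S -> int) (E : {fset S}).
Hypothesis cE : forall s, s \notin E -> c s = 0.

(** A sum over [[set: S]] takes the default value 0 when its support is infinite; the bound [E] on
    the support turns it into an honest finite sum. *)
Lemma l1normE : l1norm c = \sum_(s <- E) `|c s|.
Proof. by apply: fsbigTE => s /cE ->; rewrite normr0. Qed.

Lemma l1norm_eq0 : l1norm c = 0 -> c = cst 0.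
Proof.
rewrite l1normE => /eqP; rewrite psumr_eq0// => /allP c0; apply/funext => s /=.
have [sE|/cE//] := boolP (s \in E).
by have := c0 _ sE; rewrite normr_eq0 => /eqP.
Qed.

Section Map.
Context (T : choiceType) (h : S -> T).

Lemma pushforwardE t : Defs.pushforward h c t = \sum_(s <- E | h s == t) c s.
Proof.
rewrite [RHS]bigfs ?fset_uniq//; last by move=> s _ /cE.
by apply: eq_fsbigl; apply/seteqP; split => s /= /eqP.
Qed.

Lemma pushforward_out t : t \notin h @` E -> Defs.pushforward h c t = 0.
Proof.
move=> tE; rewrite pushforwardE big_seq_cond big1// => s /andP[sE /eqP st].
by rewrite -st in_imfset in tE.
Qed.

Lemma l1norm_pushforwardE :
  l1norm (Defs.pushforward h c) = \sum_(t <- h @` E) `|Defs.pushforward h c t|.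
Proof. by apply: fsbigTE => t /pushforward_out ->; rewrite normr0. Qed.

Lemma l1norm_pushforward_ge0 : 0 <= l1norm (Defs.pushforward h c).
Proof. by rewrite l1norm_pushforwardE sumr_ge0. Qed.

(** Group [E] by the fibres of [h] and apply the triangle inequality in each fibre. *)
Lemma l1norm_pushforward_le : l1norm (Defs.pushforward h c) <= l1norm c.
Proof.
rewrite l1norm_pushforwardE l1normE (partition_big_imfset _ h E)/=.
by apply: ler_sum => t _; rewrite pushforwardE ler_norm_sum.
Qed.

Lemma l1norm_pushforward_inj :
  {in E &, injective h} -> l1norm (Defs.pushforward h c) = l1norm c.
Proof.
move=> hE; rewrite l1norm_pushforwardE l1normE big_imfset//=.
apply: eq_big_seq => s sE; congr `|_|.
rewrite pushforwardE big_mkcond (big_fsetD1 s)//= eqxx big_seq big1 ?addr0//.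
move=> s'; rewrite !inE => /andP[ss' s'E]; case: eqP => // /hE s'sE.
by rewrite s'sE ?eqxx in ss'.
Qed.

Lemma l1norm_pushforward_contr : (forall t t' : T, t = t') ->
  l1norm (Defs.pushforward h c) = `|\sum_(s \in [set: S]) c s|.
Proof.
move=> T1; rewrite l1norm_pushforwardE (fsbigTE _ _ cE)//.
(* [T] may be empty, so a point of [E] is used to name its only element; without one both sides are
   empty sums. *)
have [->|[s0 s0E]] := fset_0Vmem E.
  by rewrite imfset0 !big_seq_fset0 normr0.
rewrite (_ : h @` E = [fset h s0]); last first.
  apply/fsetP => t; rewrite (T1 t (h s0)) !inE eqxx.
  by apply/imfsetP; exists s0.
rewrite big_seq_fset1 pushforwardE; congr `|_|.
by apply: eq_bigl => s; rewrite (T1 (h s) (h s0)) eqxx.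
Qed.

End Map.

(** Each fibre of [h] is a union of fibres of [k], so a coefficient along [h] is a sum of
    coefficients along [k]. *)
Lemma pushforward_refine (T U : choiceType) (h : S -> T) (k : S -> U) :
  (forall s s', k s = k s' -> h s = h s') ->
  Defs.pushforward k c = cst 0 -> Defs.pushforward h c = cst 0.
Proof.
move=> kh k0; apply/funext => t; rewrite pushforwardE big_mkcond/=.
rewrite (partition_big_imfset _ k E)/= big_seq big1//= => u /imfsetP[s0 _ ->].
have [st|st] := eqVneq (h s0) t; last first.
  by rewrite big1 => // s /eqP/kh ->; rewrite (negbTE st).
have : Defs.pushforward k c (k s0) = 0 by rewrite k0.
rewrite pushforwardE => ks0.
by rewrite -[RHS]ks0; apply: eq_bigr => s /eqP/kh ->; rewrite st eqxx.
Qed.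

Lemma l1norm_sum_ge0 : (forall s, 0 <= c s) ->
  `|\sum_(s \in [set: S]) c s| = l1norm c.
Proof.
move=> c0; rewrite l1normE (fsbigTE _ _ cE)// ger0_norm ?sumr_ge0//.
by apply: eq_bigr => s _; rewrite ger0_norm.
Qed.

Lemma l1norm_sum_le0 : (forall s, c s <= 0) ->
  `|\sum_(s \in [set: S]) c s| = l1norm c.
Proof.
move=> c0; rewrite l1normE (fsbigTE _ _ cE)// ler0_norm ?sumr_le0//.
by rewrite -sumrN; apply: eq_bigr => s _; rewrite ler0_norm.
Qed.

End Pushforward.

(** * Observers and the mass profile *)

Section Extrema.

Lemma maxZ_max (A : set int) M : A !=set0 -> ubound A M ->
  A (maxZ A) /\ ubound A (maxZ A).
Proof.
move=> [a Aa] AM; apply: (@xgetPex _ 0 (A `&` ubound A)).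
(* The natural number minimised is the distance to the upper bound [M], so the least [n] gives the
   largest element. *)
have exA : exists n : nat, `[< A (M - n%:Z) >].
  exists `|M - a|%N; apply/asboolP.
  by rewrite gez0_abs ?subr_ge0 ?AM// opprB addrC subrK.
case: (ex_minnP exA) => n /asboolP An nmin; exists (M - n%:Z); split => // b Ab.
have bM : 0 <= M - b by rewrite subr_ge0 AM.
have /nmin : `[< A (M - `|M - b|%N%:Z) >].
  by apply/asboolP; rewrite gez0_abs// opprB addrC subrK.
by rewrite -lez_nat gez0_abs// lerBrDr lerBrDl addrC.
Qed.

Lemma maxZ_ge (A : set int) M a : ubound A M -> A a -> a <= maxZ A.
Proof.
by move=> AM Aa; have [_] := maxZ_max (ex_intro _ _ Aa) AM; exact.
Qed.

Lemma min_infty_set0 (A : set nat) : (forall n, ~ A n) -> min_infty A = +oo%E.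
Proof. by move=> A0; apply: xgetPN => x [n [/A0]]. Qed.

Lemma min_infty_eq (A : set nat) n : A n -> (forall m, A m -> (n <= m)%N) ->
  min_infty A = (n%:Z)%:E%E.
Proof.
move=> An nmin; apply: xget_unique => [|x [m [Am mmin] <-]].
  by exists n => //; split => // m /nmin; rewrite leEnat.
congr ((Posz _)%:E)%E; apply/eqP; rewrite eqn_leq (nmin _ Am) andbT.
by have := mmin _ An; rewrite leEnat.
Qed.

Variant min_infty_spec (A : set nat) : \bar int -> Prop :=
| MinInfty_fin n of A n & (forall m, A m -> (n <= m)%N) :
    min_infty_spec A (n%:Z)%:E%E
| MinInfty_oo of (forall n, ~ A n) : min_infty_spec A +oo%E.

Lemma min_inftyP (A : set nat) : min_infty_spec A (min_infty A).
Proof.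
have [[n An]|/forallNP A0] := pselect (exists n, A n); last first.
  by rewrite min_infty_set0//; constructor.
have exA : exists n, `[< A n >] by exists n; exact/asboolP.
case: (ex_minnP exA) => m /asboolP Am mmin.
have {}mmin k : A k -> (m <= k)%N by move=> Ak; exact/mmin/asboolP.
by rewrite (min_infty_eq Am mmin); constructor.
Qed.

(** Every comparison of [dc], [cfc], [oc] and the profile threshold goes through this criterion; an
    empty [B] gives [+oo] and needs no witness. *)
Lemma le_min_infty (A B : set nat) :
  (forall n, B n -> exists2 m, A m & (m <= n)%N) ->
  (min_infty A <= min_infty B)%E.
Proof.
move=> BA; case: (min_inftyP B) => [n /BA[m Am mn] _|_]; last exact: leey.
case: min_inftyP => [k _ /(_ _ Am) km|/(_ m)//].
by rewrite lee_fin lez_nat (leq_trans km).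
Qed.

End Extrema.

(** * Finite observers: index one and refinement *)

Section Observers.
Context (G : groupType) (phi : group_end G).

Definition full_subgroup : normal_subgroup G :=
  @NormalSubgroup G setT I (fun _ _ _ _ => I) (fun _ _ => I) (fun _ _ _ => I).

Lemma quotient_full (x y : quotient_group full_subgroup) : x = y.
Proof.
by rewrite -[x]coset_repr -[y]coset_repr; exact/coset_eqP.
Qed.

Lemma finite_quotient_full : finite_set [set: quotient_group full_subgroup].
Proof.
apply: (@sub_finite_set _ _ [set coset full_subgroup 1%g]) => // x _.
exact: quotient_full.
Qed.

Definition full_observer : finite_observer phi :=
  @FiniteObserver G phi full_subgroup finite_quotient_full (fun _ _ => I).

(** Finiteness of the quotient enters here: [fset_set] of an infinite set is empty, which would give
    index 0. *)
Lemma subgroup_index_gt0 (N : finite_observer phi) : (0 < subgroup_index N)%N.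
Proof.
rewrite /subgroup_index cardfs_gt0; apply/fset0Pn; exists (coset N 1%g).
by rewrite in_fset_set ?inE//; exact: observer_finite.
Qed.

Lemma subgroup_index1 (N : finite_observer phi) :
  subgroup_index N = 1%N <-> forall x y : quotient_group N, x = y.
Proof.
have finN : finite_set [set: quotient_group N] := observer_finite N.
split=> [/eqP/cardfs1P[z Nz] x y|N1].
  have inz x' : x' = z.
    by apply/fset1P; rewrite -Nz in_fset_set ?inE.
  by rewrite (inz x) (inz y).
apply/eqP; rewrite eqn_leq subgroup_index_gt0 andbT.
rewrite /subgroup_index (_ : fset_set _ = [fset coset N 1%g])%fset ?cardfs1//.
apply/fsetP => x; rewrite in_fset_set// (N1 x (coset N 1%g)) !inE eqxx.
by apply/mem_set.
Qed.

Lemma subgroup_index_full : subgroup_index full_observer = 1%N.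
Proof. by apply/subgroup_index1; exact: quotient_full. Qed.

Lemma reidemeister_set_index1 (N : finite_observer phi) : subgroup_index N = 1%N ->
  forall a b : reidemeister_set (@induced_end G phi N), a = b.
Proof.
move=> /subgroup_index1 N1 a b; rewrite -[a]reprK -[b]reprK.
by rewrite (N1 (repr a) (repr b)).
Qed.

Lemma reidemeister_proj_refine (N N' : finite_observer phi) :
  nsub_set N' `<=` nsub_set N -> forall a b : reidemeister_set phi,
  reidemeister_proj N' a = reidemeister_proj N' b ->
  reidemeister_proj N a = reidemeister_proj N b.
Proof.
move=> N'N a b /reidemeister_classP[g bg].
(* The conjugating element is lifted from the quotient by [N'] to [G]; the relation then holds
   modulo [N'], hence modulo the larger [N]. *)
have {bg} : coset N' (repr b) = coset N' (repr g * repr a / phi (repr g))%g.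
  by rewrite bg cosetF cosetM coset_repr; congr (_ / _)%g.
move=> /coset_eqP/N'N/coset_eqP bg.
apply/reidemeister_classP; exists (coset N (repr g)).
by rewrite bg cosetF cosetM; congr (_ / _)%g; exact/esym/induced_endE.
Qed.

End Observers.

(** * The mass profile and the thresholds dc, cfc, oc *)

Section Profile.
Context (G : groupType) (phi : group_end G) (rt : reidemeister_set phi -> int).
Hypothesis finE : finite_set (trace_support rt).

Let E := fset_set (trace_support rt).

Let rtE s : s \notin E -> rt s = 0.
Proof.
move=> sE; apply/eqP; apply: contraNT sE => s0.
by rewrite in_fset_set//; apply/mem_set.
Qed.

Let masses B := [set observed_mass rt N | N in
  [set N : finite_observer phi | (subgroup_index N <= B)%N]].

Lemma observed_mass_le (N : finite_observer phi) : observed_mass rt N <= l1norm rt.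
Proof. exact: (l1norm_pushforward_le rtE). Qed.

Lemma observed_mass_ge0 (N : finite_observer phi) : 0 <= observed_mass rt N.
Proof. exact: (l1norm_pushforward_ge0 rtE). Qed.

Lemma observed_mass_index1 (N : finite_observer phi) : subgroup_index N = 1%N ->
  observed_mass rt N = `|lefschetz_number rt|.
Proof.
move=> N1; apply: (l1norm_pushforward_contr rtE).
exact: reidemeister_set_index1.
Qed.

Let massesP B : (0 < B)%N -> masses B !=set0.
Proof.
move=> B0; exists (observed_mass rt (full_observer phi)).
by exists (full_observer phi); rewrite //= subgroup_index_full.
Qed.

Let masses_ub B : ubound (masses B) (l1norm rt).
Proof. by move=> _ [N _ <-]; exact: observed_mass_le. Qed.

Lemma mass_profile_attained B : (0 < B)%N ->
  exists2 N : finite_observer phi,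
    (subgroup_index N <= B)%N & observed_mass rt N = mass_profile rt B.
Proof.
move=> /massesP B0; have [[N NB NE] _] := maxZ_max B0 (@masses_ub B).
by exists N => //; rewrite NE.
Qed.

Lemma observed_mass_le_profile (N : finite_observer phi) B :
  (subgroup_index N <= B)%N -> observed_mass rt N <= mass_profile rt B.
Proof.
by move=> NB; apply: (maxZ_ge (@masses_ub B)); exists N.
Qed.

Lemma le_mass_profile B B' : (0 < B)%N -> (B <= B')%N ->
  mass_profile rt B <= mass_profile rt B'.
Proof.
move=> B0 BB'; have [N NB <-] := mass_profile_attained B0.
by apply: observed_mass_le_profile; exact: leq_trans BB'.
Qed.

Lemma mass_profile_bounds B : (0 < B)%N -> 0 <= mass_profile rt B <= l1norm rt.
Proof.
move=> B0; have [N NB <-] := mass_profile_attained B0.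
by rewrite observed_mass_ge0 observed_mass_le.
Qed.

(** A [B] where the profile is full yields an observer of full mass and index at most [B];
    conversely the index of a full-mass observer is such a [B]. The condition [0 < B] matters: at
    [B = 0] there is no observer and the profile has the default value 0, a spurious solution when
    the trace vanishes. *)
Lemma cfc_profile :
  cfc rt = min_infty [set B : nat | (0 < B)%N /\ mass_profile rt B = l1norm rt].
Proof.
apply/eqP; rewrite eq_le; apply/andP; split; apply: le_min_infty.
  move=> B [B0 BE]; have [N NB NE] := mass_profile_attained B0.
  by exists (subgroup_index N) => //; exists N; rewrite //= NE.
move=> _ [N NE <-]; exists (subgroup_index N) => //; split.
  exact: subgroup_index_gt0.
have /andP[_ le1] := mass_profile_bounds (subgroup_index_gt0 N).
by apply/eqP; rewrite eq_le le1 -NE observed_mass_le_profile.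
Qed.

(** An observer of full mass with zero observed trace would force the whole trace to have norm 0,
    contradicting a nonempty support. *)
Lemma dc_le_cfc : (0 < nielsen_number rt)%N -> (dc rt <= cfc rt)%E.
Proof.
rewrite cardfs_gt0 => /fset0Pn[s].
rewrite in_fset_set// inE /trace_support/= => s0.
apply: le_min_infty => _ [N NE <-]; exists (subgroup_index N) => //.
exists N => // N0; move: s0; rewrite (@l1norm_eq0 _ rt E rtE) ?eqxx//.
by rewrite -NE /observed_mass N0 /l1norm fsbig1// => i _; rewrite normr0.
Qed.

Lemma cfc_le_oc : (cfc rt <= oc rt)%E.
Proof.
apply: le_min_infty => _ [N Ninj <-]; exists (subgroup_index N) => //.
exists N => //; apply: (l1norm_pushforward_inj rtE) => a b.
rewrite !in_fset_set// !inE => aE bE; exact: (Ninj a b (mem_set aE) (mem_set bE)).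
Qed.

(** Indices are positive, so 1 is the minimum as soon as it is attained. *)
Lemma min_index_eq1 (P : finite_observer phi -> Prop) :
  min_index P = 1%:E%E <-> exists2 N, P N & subgroup_index N = 1%N.
Proof.
split=> [|[N PN N1]].
  rewrite /min_index; case: min_inftyP => // _ [N PN <-] _ [N1].
  by exists N.
apply: min_infty_eq; first by exists N.
by move=> _ [N' _ <-]; exact: subgroup_index_gt0.
Qed.

Lemma cfc_eq1 : cfc rt = 1%:E%E <-> `|lefschetz_number rt| = l1norm rt.
Proof.
split=> [/min_index_eq1[N NE N1]|LE]; first by rewrite -(observed_mass_index1 N1).
apply/min_index_eq1; exists (full_observer phi); last exact: subgroup_index_full.
by rewrite observed_mass_index1// subgroup_index_full.
Qed.

Lemma cfc_one_sign :
  (forall alpha, 0 <= rt alpha) \/ (forall alpha, rt alpha <= 0) ->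
  cfc rt = 1%:E%E.
Proof.
move=> rt_sign; apply/cfc_eq1; case: rt_sign => [rt0|rt0].
  exact: (l1norm_sum_ge0 rtE).
exact: (l1norm_sum_le0 rtE).
Qed.

Lemma dc_eq1 : lefschetz_number rt <> 0 -> dc rt = 1%:E%E.
Proof.
move=> L0; apply/min_index_eq1.
exists (full_observer phi); last exact: subgroup_index_full.
move=> N0; apply: L0; apply/eqP; rewrite -normr_eq0.
rewrite -(observed_mass_index1 (subgroup_index_full phi)) /observed_mass N0.
by rewrite /l1norm fsbig1// => i _; rewrite normr0.
Qed.

Lemma observed_trace_refine (N N' : finite_observer phi) :
  nsub_set N' `<=` nsub_set N ->
  observed_trace rt N <> cst 0 -> observed_trace rt N' <> cst 0.
Proof.
move=> N'N NN0 N'0; apply: NN0.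
exact: (pushforward_refine rtE (reidemeister_proj_refine N'N) N'0).
Qed.

End Profile.

(** * Path lifting and deck transformations *)

(** [P] is locally constant on [A], so [A] intersected with [P] is open and closed in [A]. It serves
    both uniqueness of lifts and existence of path lifts. *)
Lemma connected_propagation (T : topologicalType) (A : set T) (P : T -> Prop) :
  connected A ->
  (forall t, A t -> exists2 W, nbhs t W &
     forall s s', W s -> A s -> W s' -> A s' -> P s -> P s') ->
  forall a, A a -> P a -> forall t, A t -> P t.
Proof.
move=> cA loc a Aa Pa; suff <- : A `&` P = A by move=> t [].
apply: cA; first by exists a.
- exists (interior [set s | A s -> P s]); first exact: open_interior.
  apply/seteqP; split=> t [At Pt]; split=> //; last exact: (nbhs_singleton Pt).
  have [W Wt WP] := loc _ At; apply: filterS (Wt) => s Ws As.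
  exact: (WP t s (nbhs_singleton Wt)).
- exists (closure (A `&` P)); first exact: closed_closure.
  apply/seteqP; split=> t [At Pt]; split=> //; first exact: subset_closure.
  have [W Wt WP] := loc _ At; have [s [[As Ps] Ws]] := Pt _ Wt.
  exact: (WP s t Ws As (nbhs_singleton Wt)).
Qed.

Lemma compact_finite_meet (T : topologicalType) (A : set T) (J : choiceType)
    (F : J -> set T) : compact A ->
  (forall x, A x -> exists2 W, nbhs x W & finite_set [set j | F j `&` W !=set0]) ->
  finite_set [set j | F j `&` A !=set0].
Proof.
move=> /compact_near_coveringP cA loc.
pose above (D : set J) := [set D' : set J | finite_set D' /\ D `<=` D'].
(* The filter of sufficiently large finite index sets: compactness in near-covering form then merges
   the local finite sets into one finite [D]. *)
pose Phi := filter_from (@finite_set J) above.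
have PhiF : Filter Phi.
  apply: filter_from_filter; first by exists set0; exact: finite_set0.
  move=> D D' fD fD'; exists (D `|` D'); first by rewrite finite_setU.
  by move=> D'' [fD'' sub]; split; split => // j Dj; apply: sub; [left|right].
have /= [|D fD DP] := cA _ Phi (fun D x => forall j, F j x -> D j) PhiF.
  move=> x /loc[W Wx Wfin]; exists (W, above [set j | F j `&` W !=set0]) => /=.
    by split => //; exists [set j | F j `&` W !=set0].
  by move=> [z D] [/= Wz [_ sub]] j Fjz; apply: sub; exists z.
apply: (sub_finite_set _ fD) => j [x [Fjx Ax]].
by apply: (DP D _ _ Ax _ Fjx); split.
Qed.

Section Covering.
Context (X Xt : topologicalType) (p : Xt -> X).
Hypothesis cp : covering_map p.

(** Near [t] each lift stays in one sheet; agreement at a single point makes the two sheets equal,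
    and [p] is injective on a sheet. *)
Lemma unique_lift (T : topologicalType) (A : set T) (u v : T -> Xt) :
  connected A -> {within A, continuous u} -> {within A, continuous v} ->
  (forall t, A t -> p (u t) = p (v t)) ->
  forall a, A a -> u a = v a -> forall t, A t -> u t = v t.
Proof.
move=> cA /subspace_continuousP cu /subspace_continuousP cv puv.
apply: connected_propagation => // t At.
have [_ _ /(_ (p (u t)))[U [oU Ut] [S [dS SU SV]]]] := cp.
have [V VS Vt] : (\bigcup_(V in S) V) (u t) by rewrite -SU.
have [V' V'S V't] : (\bigcup_(V in S) V) (v t) by rewrite -SU /= -puv.
have [oV bV _] := SV _ VS; have [oV' _ _] := SV _ V'S.
have Wu : nbhs t (fun s => A s -> V (u s)) := cu t At V (open_nbhs_nbhs (conj oV Vt)).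
have Wv : nbhs t (fun s => A s -> V' (v s)) := cv t At V' (open_nbhs_nbhs (conj oV' V't)).
exists ((fun s => A s -> V (u s)) `&` (fun s => A s -> V' (v s))).
  exact: filterI.
move=> s s' [Vs V's] As [Vs' V's'] As' uvs.
have VV' : V = V'.
  apply: (dS V V' VS V'S); exists (u s); split; first exact: Vs.
  by rewrite /= uvs; exact: V's.
have [_ injp _] := bV; apply: injp; last exact: puv.
  by apply/mem_set; exact: Vs'.
by apply/mem_set; rewrite VV'; exact: V's'.
Qed.

Lemma local_section (U : set X) (V : set Xt) (y0 : Xt) :
  open U -> open V -> set_bij V U p ->
  (forall V', open V' -> V' `<=` V -> open (p @` V')) ->
  exists q : X -> Xt, {within U, continuous q} /\
    forall x, U x -> V (q x) /\ p (q x) = x.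
Proof.
move=> oU oV [Vp injp surjp] op.
pose q x := xget y0 [set y | V y /\ p y = x].
have qP x : U x -> V (q x) /\ p (q x) = x.
  move=> /surjp[y Vy pyx].
  exact: (@xgetPex _ y0 [set y | V y /\ p y = x] (ex_intro _ y (conj Vy pyx))).
exists q; split => //; apply/subspace_continuousP => x Ux B.
rewrite nbhsE => -[B' [oB' B'q] B'B]; have [Vq pq] := qP _ Ux.
have oW : open (p @` (B' `&` V)) by apply: op; [exact: openI|move=> ? []].
suff : nbhs x (fun z => U z -> B (q z)) by [].
have : nbhs x (p @` (B' `&` V)).
  by apply: open_nbhs_nbhs; split => //; exists (q x).
apply: filterS => _ [w [B'w Vw] <-] /qP[Vqw pqw]; apply: B'B.
by rewrite (injp (q (p w)) w (mem_set Vqw) (mem_set Vw) pqw).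
Qed.

Lemma path_lifting (R : realType) (c : R -> X) (y : Xt) :
  {within `[0, 1], continuous c} -> p y = c 0 ->
  exists u : R -> Xt, [/\ {within `[0, 1], continuous u}, u 0 = y &
    forall t, 0 <= t <= 1 -> p (u t) = c t].
Proof.
move=> cc py0.
(* Existence of a lift on [[0, t]] is propagated from [t = 0] to [t = 1]: going down restricts the
   lift, going up extends it by a local section of the sheet through its endpoint. *)
pose lifted (t : R) := exists u : R -> Xt,
  [/\ {within `[0, t], continuous u}, u 0 = y &
    forall s, 0 <= s <= t -> p (u s) = c s].
suff : forall t : R, `[0, 1]%classic t -> lifted t.
  by apply; rewrite /= in_itv/= lexx ler01.
apply: (@connected_propagation R `[0, 1] lifted (@segment_connected _ 0 1) _ 0).
- move=> t t01; have [_ _ /(_ (c t))[U [oU Ut] [S [dS SU SV]]]] := cp.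
  have /nbhs_ballP[e /= e0 eU] : nbhs t (fun s => `[0, 1]%classic s -> U (c s)).
    move/subspace_continuousP : cc => /(_ t t01); apply.
    exact: open_nbhs_nbhs.
  exists (ball t e); first exact: nbhsx_ballx.
  move=> s s' ts; rewrite !in_itv/= => s01 ts' s'01 [u [cu u0 pu]].
  have [s's|ss'] := leP s' s.
    exists u; split => //; last first.
      by move=> r /andP[r0 rs']; apply: pu; rewrite r0 (le_trans rs').
    apply: continuous_subspaceW cu => r /=; rewrite !in_itv/= => /andP[-> rs'].
    exact: le_trans s's.
  have cU r : s <= r <= s' -> U (c r).
    move=> /andP[sr rs']; apply: eU; last by rewrite in_itv/=; lra.
    by move: ts ts'; rewrite /ball/= !ltr_norml; lra.
  have [V VS Vs] : (\bigcup_(V in S) V) (u s).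
    by rewrite -SU /= pu ?lexx ?andbT; [apply: cU; lra|lra].
  have [oV bV op] := SV _ VS.
  have [q [cq qP]] := local_section y oU oV bV op.
  have us : u s = q (c s).
    have [_ injp _] := bV; have [Vq pq] := qP _ (cU s ltac:(lra)).
    by apply: injp; [exact/mem_set|exact/mem_set|rewrite pq pu//; lra].
  exists (fun r => if r <= s then u r else q (c r)); split.
  + apply: (@within_paste R R Xt _ id s _ u (q \o c)).
    * exact: itv_closed.
    * by move=> ?; exact: cvg_id.
    * by apply: continuous_subspaceW cu => r /=; rewrite !in_itv/=; lra.
    * apply: (within_comp cq) => [|r /=]; last first.
        by rewrite in_itv/= => -[? ?]; apply: cU; lra.
      by apply: continuous_subspaceW cc => r /=; rewrite !in_itv/=; lra.
    * by move=> r _ ->.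
    * move=> r _; rewrite le_eqVlt => /predU1P[<-|]; first by rewrite lexx us.
      by rewrite ltNge => /negbTE ->.
  + by rewrite ifT//; lra.
  + move=> r r01; case: leP => rs; first by apply: pu; lra.
    by have [] := qP _ (cU r ltac:(lra)).
- by rewrite /= in_itv/= lexx ler01.
- exists (cst y); split => //.
    by apply: continuous_subspaceT; exact: cst_continuous.
  by move=> s ?; rewrite (_ : s = 0)//; lra.
Qed.

End Covering.

(** * The deck action is free and transitive on fibres *)

Section DeckAction.
Context (R : realType) (X Xt : topologicalType) (x0 : X) (p : Xt -> X).
Context (xt0 : Xt) (act : pi1 R x0 -> Xt -> Xt).
Hypothesis cp : universal_cover R p.
Hypothesis hact : deck_action p xt0 act.

Let itv01_0 : `[0, 1]%classic (0 : R).
Proof. by rewrite /= in_itv/= lexx ler01. Qed.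

Let itv01_1 : `[0, 1]%classic (1 : R).
Proof. by rewrite /= in_itv/= lexx ler01. Qed.

Lemma projected_path (u : R -> Xt) (y y' : Xt) : is_path y y' u ->
  is_path (p y) (p y') (p \o u).
Proof.
move=> [cu u0 u1]; split; rewrite /= ?u0 ?u1//.
apply: (@within_comp _ _ _ _ setT) => //.
by apply: continuous_subspaceT; have [[]] := cp.
Qed.

(** The lift of a representing loop closes up at [xt0], hence contracts in the simply connected
    cover; [p] carries the contraction down to [X]. *)
Lemma deck_base_free (g : pi1 R x0) : act g xt0 = xt0 -> g = 1%g.
Proof.
have [p0 _ _ _ lift] := hact.
rewrite -[g]reprK; set a := repr g; have [ca a0 a1] := loop_path a.
have [u [cu u0 pu]] := path_lifting (proj1 cp) ca (etrans p0 (esym a0)).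
rewrite -/(loop_class a) (lift a u)// => u1.
have [H [cH H0 H1]] := (proj2 (proj2 cp)) _ _ (And3 cu u0 u1).
apply/pi1P; apply: (@homotopic_trans _ _ (p \o u)).
  by apply: eq_homotopic => // t t01; rewrite /= pu.
exists (p \o H); split => /=.
- apply: (@within_comp _ _ _ _ setT) => //.
  by apply: continuous_subspaceT; have [[]] := cp.
- by move=> t /H0[-> ->].
- by move=> s /H1[-> ->].
Qed.

(** Along a path from [xt0] to [y], the path and its translate by [g] lift the same path and agree
    at [y], hence also at [xt0]. *)
Lemma deck_free (g : pi1 R x0) (y : Xt) : act g y = y -> g = 1%g.
Proof.
have [_ _ cact pact _] := hact; have [pathXt _] := proj2 cp.
move=> gy; apply: deck_base_free.
have [u [cu u0 u1]] := pathXt xt0 y; rewrite -u0.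
apply: (@unique_lift _ _ _ (proj1 cp) R `[0, 1] (act g \o u) u
  (@segment_connected _ 0 1) _ cu _ 1) => //=; last by rewrite u1.
apply: (@within_comp _ _ _ _ setT) => //.
exact: continuous_subspaceT.
Qed.

Lemma deck_transitive (y y' : Xt) : p y = p y' -> exists g, act g y = y'.
Proof.
have [p0 _ cact pact lift] := hact; have [pathXt _] := proj2 cp.
move=> pyy'; have [u pu] := pathXt xt0 y; have [cu u0 u1] := pu.
have [cpu' pu'0 pu'1] := projected_path (path_rev_path pu).
(* Reduction to the fibre over [x0]: the path from [y] back to [xt0] is projected and lifted again
   from [y'], ending at [v 1]. A path [w] from [xt0] to [v 1] projects to the loop defining [g], and
   uniqueness of lifts carries the agreement at time 1 back to time 0. *)
have [v [cv v0 pv]] := path_lifting (proj1 cp) cpu' (etrans (esym pyy') (esym pu'0)).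
have [w pw] := pathXt xt0 (v 1); have [cw w0 w1] := pw.
have pv1 : p (v 1) = x0 by rewrite pv ?lexx ?ler01// pu'1.
have lw : is_path x0 x0 (p \o w).
  by have := projected_path pw; rewrite p0 pv1.
pose g := loop_class (Loop lw).
have gw : act g xt0 = v 1 by rewrite -w1; exact: lift.
exists g; rewrite -v0.
have -> : y = path_rev u 0 by rewrite /path_rev subr0 u1.
apply: (@unique_lift _ _ _ (proj1 cp) R `[0, 1] (act g \o path_rev u) v
  (@segment_connected _ 0 1) _ cv _ 1) => //=.
- apply: (@within_comp _ _ _ _ setT) => //; first exact: continuous_subspaceT.
  by have [] := path_rev_path pu.
- by move=> t; rewrite in_itv/= => t01; rewrite pact pv.
- by rewrite /path_rev subrr u0.
Qed.

End DeckAction.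

(** * Finiteness of the Reidemeister trace *)

Lemma disk_compact (R : realType) n : compact (@disk R n).
Proof.
apply: bounded_closed_compact.
- exists 1; split => [|M M1 v vd]; first exact: real1.
  (* The matrix norm is the maximum norm, so each squared coordinate is compared with [sqnorm]. *)
  apply: le_trans (ltW M1); rewrite [leLHS]/Num.norm/= mx_normrE.
  apply: bigmax_le => // -[i j] _ /=; rewrite (ord1 i).
  rewrite -(@expr_le1 _ 2)// real_normK ?num_real//.
  apply: le_trans vd; rewrite /sqnorm (bigD1 j)//= lerDl.
  by apply: sumr_ge0 => k _; exact: sqr_ge0.
- rewrite (_ : @disk R n = @sqnorm R n @^-1` [set x | x <= 1])//.
  apply: (continuous_closedP _).1; last exact: closed_le.
  apply: continuous_big => [|i _ v]; first exact: add_continuous.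
  by apply: (@continuous_comp _ _ _ (fun v : 'rV[R]_n => v ord0 i) (fun x => x ^+ 2));
    [exact: coord_continuous|exact: exprn_continuous].
Qed.

Lemma finite_cw_compact (R : realType) (X : topologicalType) :
  finite_cw_complex R X -> compact [set: X].
Proof.
move=> K; rewrite (_ : setT = \big[setU/set0]_(e : cell K)
    (@char_map R X K e @` @disk R (cell_dim e))).
  apply: bigsetU_compact => e _; apply: continuous_compact.
    exact: cw_continuous.
  exact: disk_compact.
apply/seteqP; split => // x _.
have [e _ [v vd <-]] : (\bigcup_(e in setT) open_cell (f := K) e) x.
  by rewrite cw_cover.
rewrite (bigD1 e)//=; left; exists v => //; exact: ltW.
Qed.

(** The empty set is an admissible neighbourhood, where the degree is an empty sum, computed with
    the constant map 0. If no integer qualifies as index, the default is 0 as well. *)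
Lemma fixed_point_index_set0 (R : realType) (X : topologicalType) (f : X -> X) :
  fixed_point_index R f set0 = 0.
Proof.
rewrite /fixed_point_index; case: xgetP => // k _ [n [D [j [r [_ _ _ _ deg]]]]].
have /(_ (cst 0)) -> : is_brouwer_degree (fun x => x - j (f (r x))) set0 k.
- apply: deg; rewrite ?closure0 ?set0I ?image_set0//.
  by exists 0; split => // M _ v.
- by rewrite set0I fsbig_set0.
- split => [x|]; first exact: differentiable_cst.
  rewrite (_ : (fun x => _) = cst (lin1_mx 0)); first exact: cst_continuous.
  by apply/funext => x; rewrite /jacobian diff_cst.
- by [].
- by move=> x y; rewrite closure0.
Qed.

Section FixedPointClasses.
Context (R : realType) (X Xt : topologicalType) (x0 : X) (p : Xt -> X).
Context (xt0 : Xt) (act : pi1 R x0 -> Xt -> Xt) (f : X -> X) (ft : Xt -> Xt).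
Context (phi : group_end (pi1 R x0)).
Hypothesis cp : universal_cover R p.
Hypothesis hact : deck_action p xt0 act.
Hypothesis hft : continuous ft.
Hypothesis hlift : forall x, p (ft x) = f (p x).
Hypothesis hphi : forall g x, ft (act g x) = act (phi g) (ft x).

Lemma fixed_point_class_sub (a : pi1 R x0) :
  fixed_point_class p act ft a `<=` fixed_points f.
Proof.
move=> _ [y ya <-]; have [_ _ _ pact _] := hact.
by rewrite /fixed_points/= -hlift -(pact a); congr p.
Qed.

Lemma fixed_point_class_local (x : X) : hausdorff_space X -> continuous f ->
  exists2 W, nbhs x W & exists a0 : pi1 R x0, forall a,
    fixed_point_class p act ft a `&` W !=set0 ->
    reidemeister_class phi a = reidemeister_class phi a0.
Proof.
move=> hX cf; have [_ [act1 actM] cact pact _] := hact.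
have [_ rangep /(_ x)[U [oU Ux] [S [_ SU SV]]]] := proj1 cp.
(* If [x] is not fixed, separating [x] from [f x] gives a neighbourhood free of fixed points, and
   [a0] is arbitrary. *)
have [fx|/eqP fx] := eqVneq (f x) x; last first.
  move: hX; rewrite open_hausdorff => /(_ (f x) x)[|[A B] /= [Afx Bx]].
    exact/eqP.
  move=> [oA oB /eqP/seteqP[AB _]]; exists (B `&` f @^-1` A).
    apply: filterI; first by apply: open_nbhs_nbhs; split => //; exact/set_mem.
    by apply: cf; apply: open_nbhs_nbhs; split => //; exact/set_mem.
  exists 1%g => a [z [/fixed_point_class_sub fz [Bz Az]]].
  by have [] := AB z; split => //; rewrite -fz.
have [y _ yx] : range p x by rewrite rangep.
have [a0 a0y] : exists a0, act a0 (ft y) = y.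
  by apply: (deck_transitive cp hact); rewrite hlift yx fx.
have [V VS Vy] : (\bigcup_(V in S) V) y by rewrite -SU /= yx.
have [oV [_ injp _] op] := SV _ VS.
(* On [V1] both [v] and [act a0 (ft v)] lie in the sheet [V], so they coincide as soon as [p v] is
   fixed by [f]. *)
pose V1 := V `&` (act a0 \o ft) @^-1` V.
have oV1 : open V1.
  apply: openI => //; apply: open_comp => // z _.
  by apply: continuous_comp; [exact: hft|exact: cact].
exists (p @` V1).
  apply: open_nbhs_nbhs; split; first by apply: op => // z [].
  by exists y => //; split => //=; rewrite a0y.
exists a0 => a [z [[w wa pw] [v [Vv Va0v] pv]]].
have fv : act a0 (ft v) = v.
  apply: injp; [exact/mem_set|exact/mem_set|].
  have : fixed_points f z by apply: (@fixed_point_class_sub a); exists w.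
  by rewrite pact hlift pv.
have [g gv] := deck_transitive cp hact (etrans pv (esym pw)).
apply/esym/reidemeister_classP; exists g.
suff : (a^-1 * (g * a0 / phi g) = 1)%g.
  by move=> /(congr1 (fun b => a * b)%g); rewrite mulVKg mulg1.
(* With [w = act g v], the element [a^-1 * (g * a0 / phi g)] fixes [ft w], so freeness makes it
   trivial. *)
have phig : act (phi g)^-1%g (ft w) = ft v by rewrite -gv hphi -actM mulVg act1.
apply: (deck_free cp hact (y := ft w)).
by rewrite !actM phig fv gv -{1}wa -actM mulVg act1.
Qed.

Lemma reidemeister_trace_finite_support : hausdorff_space X -> continuous f ->
  compact [set: X] ->
  finite_set (trace_support (reidemeister_trace p act f ft phi)).
Proof.
move=> hX cf cX.
pose F (alpha : reidemeister_set phi) := fixed_point_class p act ft (repr alpha).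
apply: (@sub_finite_set _ _ [set alpha | F alpha `&` setT !=set0]).
  move=> alpha /=; rewrite /trace_support/= setIT => /eqP rt0.
  apply/set0P/negP => /eqP F0; apply: rt0.
  by rewrite /reidemeister_trace -/(F alpha) F0 fixed_point_index_set0.
apply: compact_finite_meet => // x _.
have [W Wx [a0 Wa0]] := fixed_point_class_local x hX cf; exists W => //.
apply: (sub_finite_set _ (finite_set1 (reidemeister_class phi a0))).
by move=> alpha /Wa0 /= <-; rewrite [RHS]reprK.
Qed.

End FixedPointClasses.

Theorem proposition5p5 (R : realType)
    (X : topologicalType) (K : finite_cw_complex R X) (x0 : X)
    (hX : connected [set: X])
    (f : X -> X) (hf : cellular K f)
    (Xt : topologicalType) (p : Xt -> X) (hp : universal_cover R p)
    (xt0 : Xt) (act : pi1 R x0 -> Xt -> Xt) (hact : deck_action p xt0 act)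
    (ft : Xt -> Xt) (hft : continuous ft) (hlift : forall x, p (ft x) = f (p x))
    (phi : group_end (pi1 R x0))
    (hphi : forall g x, ft (act g x) = act (phi g) (ft x)) :
  let rt := reidemeister_trace p act f ft phi in
  [/\
   (* (i) *)
   (forall B B' : nat, (0 < B)%N -> (B <= B')%N ->
      mass_profile rt B <= mass_profile rt B') /\
   (forall B : nat, (0 < B)%N -> 0 <= mass_profile rt B <= l1norm rt),
   (* (ii) *)
   cfc rt = min_infty [set B : nat | (0 < B)%N /\ mass_profile rt B = l1norm rt],
   (* (iii) *)
   (0 < nielsen_number rt)%N -> (dc rt <= cfc rt)%E /\ (cfc rt <= oc rt)%E,
   (* (iv) *)
   (cfc rt = 1%:E%E <-> `|lefschetz_number rt| = l1norm rt) /\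
   ((forall alpha, 0 <= rt alpha) \/ (forall alpha, rt alpha <= 0) ->
      cfc rt = 1%:E%E)
   & (* (v) *)
   (lefschetz_number rt <> 0 -> dc rt = 1%:E%E) /\
   (* (vi) *)
   (forall N N' : finite_observer phi, nsub_set N' `<=` nsub_set N ->
      observed_trace rt N <> cst 0 -> observed_trace rt N' <> cst 0)].
Proof.
move=> rt; have [cf _] := hf.
(* Finite support is the only topological input; the six claims then hold for any finitely supported
   [rt]. *)
have finE : finite_set (trace_support rt).
  apply: (reidemeister_trace_finite_support hp hact hft hlift hphi) => //.
    exact: (cw_hausdorff K).
  exact: finite_cw_compact K.
split.
- by split=> [B B'|B]; [exact: le_mass_profile|exact: mass_profile_bounds].
- exact: cfc_profile.
- by move=> N0; split; [exact: dc_le_cfc|exact: cfc_le_oc].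
- by split; [exact: cfc_eq1|exact: cfc_one_sign].
- by split; [exact: dc_eq1|move=> N N'; exact: observed_trace_refine].
Qed.
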